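(* Let $\mathbb{F}_q$ be a finite field and let $k,t,n,\eta$ be integers with $1\le t\le k$, $1\le\eta\le n-2$ and $n\le\frac{q^{t(n-\eta)}-1}{q^t-1}$. Then there exist a vector space $\mathcal{V}$ over $\mathbb{F}_q$ and a $(k,k-t)$-SCID $\{\pi_1,\ldots,\pi_n\}$ in $\mathcal{V}$ with $n$ elements such that \[\dim S+\dim I=2k+(n-2)t-\eta t,\] where $S:=\langle\pi_1,\ldots,\pi_n\rangle$ and $I:=\langle \pi_i\cap\pi_j\mid i\neq j\rangle$.
   Context: A $(k,k-t)$-SCID is a set of (distinct) $k$-dimensional subspaces of a vector space, containing at least two elements, such that any two distinct members intersect in a subspace of dimension exactly $k-t$. $\langle\cdot\rangle$ denotes the span. The dimension of the ambient vector space is not fixed in advance. *)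

(* Defs.v *)
From HB Require Import structures.
From mathcomp Require Import all_boot all_order all_algebra.

Set Implicit Arguments.
Unset Strict Implicit.
Unset Printing Implicit Defensive.

Import GRing.Theory.

(* (k, m)-SCID: the intersection dimension m is written k - t in the usual
   "(k, k - t)-SCID". *)
Definition SCID (F : fieldType) (V : vectType F) (k m : nat)
    (A : {pred {vspace V}}) : Prop :=
  [/\ exists U W : {vspace V}, [/\ U \in A, W \in A & U != W],
      forall U : {vspace V}, U \in A -> \dim U = k
    & forall U W : {vspace V}, U \in A -> W \in A -> U != W ->
        \dim (U :&: W)%VS = m].

(* Main.v *)
(* A sunflower: all members share a common (k-t)-dimensional center, and modulo
   the center they are t-dimensional subspaces which pairwise meet trivially.
   With [m := n - eta] and [L] the extension of [F] of degree [t], the 1-dimensional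
   [L]-subspaces of [L^m] are such t-dimensional [F]-subspaces; there are
   [(q^(tm) - 1) / (q^t - 1) >= n] of them, and since [m <= n] we can pick [n] of
   them including the [m] coordinate axes.  Then [I] is the center and [S] is the
   whole space, so [dim S + dim I = (k - t + t m) + (k - t)]. *)
Require Import Defs.
From HB Require Import structures.
From mathcomp Require Import all_boot all_order all_algebra.
From mathcomp Require Import all_fingroup all_solvable all_field.
From mathcomp Require Import zify.

Set Implicit Arguments.
Unset Strict Implicit.
Unset Printing Implicit Defensive.

Import GRing.Theory.

(** * Extensions of a finite field of prescribed degree *)

Section FiniteFieldExtension.

Local Open Scope ring_scope.

(** Take the splitting field of [X^Q - X] over [F], where [Q = q^t], and bound its degree from both
    sides. *)
Lemma finField_ext_exists (F : finFieldType) (t : nat) :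
  (0 < t)%N -> exists L : fieldExtType F, \dim {:L} = t.
Proof.
move=> t_gt0; set Q := (#|F| ^ t)%N.
have q_gt1 : (1 < #|F|)%N := finNzRing_gt1 F.
have Q_gt1 : (1 < Q)%N by rewrite -(expn0 #|F|) ltn_exp2l.
have sizeXX (R : nzRingType) : size ('X^Q - 'X : {poly R}) = Q.+1.
  by rewrite size_polyDl size_polyXn // size_polyN size_polyX.
have /FinSplittingFieldFor[L [zs Dzs defL]] : 'X^Q - 'X != 0 :> {poly F}.
  by rewrite -size_poly_gt0 sizeXX.
rewrite rmorphB /= map_polyXn map_polyX in Dzs.
exists L; apply/eqP; rewrite eqn_leq; apply/andP; split.
(* The Frobenius [x |-> x^q] generates the Galois group and its [t]-th power fixes
   the roots of [X^Q - X], hence [L]; conversely these [Q] roots are distinct. *)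
- have /finField_galois_generator[a gen_a Da] : (1 <= {:L})%VS by apply: sub1v.
  have {}Da x : a x = x ^+ #|F| by rewrite Da ?memvf // dimv1 expn1.
  have Dat i x : (a ^+ i)%g x = x ^+ (#|F| ^ i).
    elim: i => [|i IHi]; first by rewrite gal_id.
    by rewrite expgSr expnSr exprM galM ?memvf // IHi Da.
  have fixL x : (a ^+ t)%g x = x.
    apply/fixedSpaceP; suff -> : fixedSpace (a ^+ t)%g = {:L}%VS by apply: memvf.
    apply/eqP; rewrite eqEsubv subvf -defL -[X in (_ <= X)%VS]subfield_closed.
    rewrite agenvS // subv_add sub1v; apply/span_subvP=> z zs_z.
    apply/fixedSpaceP; rewrite Dat.
    have : root ('X^Q - 'X) z by rewrite (eqp_root Dzs) root_prod_XsubC.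
    by rewrite rootE !hornerE subr_eq0 => /eqP.
  have at1 : (a ^+ t = 1)%g.
    by apply/eqP/gal_eqP => x _; rewrite fixL gal_id.
  (* The degree is the order of the Galois group, hence of its generator [a], which divides [t]. *)
  have /galois_dim : galois 1 {:L} by apply/finField_galois/sub1v.
  rewrite dimv1 divn1 => ->.
  rewrite (eqP gen_a) -orderE dvdn_leq //.
  by rewrite order_dvdn at1.
(* This makes the derivative of [X^Q - X] equal to [-1], so the polynomial is separable. *)
- have Q0 : Q%:R = 0 :> L.
    have [p p_pr pF] := finPcharP F; rewrite -(pchar_lalg L) in pF.
    have pchF : p \in [pchar F] by rewrite -(pchar_lalg L).
    rewrite /Q (card_pprimeChar pchF) -expnM natrX (pcharf0 pF) expr0n.
    case: eqP => // e0; move: Q_gt1.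
    by rewrite /Q (card_pprimeChar pchF) -expnM e0.
  have Uzs : uniq zs.
    rewrite -separable_prod_XsubC -(eqp_separable Dzs) separable_poly.unlock.
    rewrite derivB derivXn derivX -mulr_natl -polyC_natr Q0 mul0r sub0r.
    by rewrite -[- 1]scaleN1r coprimepZr ?oppr_eq0 ?oner_eq0 // coprimep1.
  (* The [q^t] distinct roots lie in [L], which has [q^(\dim {:L})] elements. *)
  rewrite -(leq_exp2l _ _ q_gt1) -/Q -ltnS -(sizeXX L) (eqp_size Dzs).
  rewrite size_prod_XsubC ltnS.
  rewrite -(@card_vspace F (finvect_type L) _ {:L}%VS).
  rewrite -(card_uniqP (T := finvect_type L) Uzs).
  by apply/subset_leq_card/subsetP => x _; rewrite (memvf (x : L)).
Qed.

End FiniteFieldExtension.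

(** * Normalized representatives of the lines of [K^m] *)

Section ProjectivePoints.

Local Open Scope ring_scope.

Variables (K : fieldType) (m : nat).
Implicit Types v w : {ffun 'I_m -> K}.

(** Scaling by [K] is kept apart from [*:], which in the sunflower construction is scaling by the
    smaller field [F]. *)
Definition scale_ffun (c : K) v := [ffun i => c * v i].

Definition unit_ffun (i : 'I_m) := [ffun j => (i == j)%:R : K].

(* The condition [lead v = 1] selects one representative of each line of [K^m]. *)
Definition lead v := if [pick i | v i != 0] is Some i then v i else 0.

Lemma lead_eq0 v : (lead v == 0) = (v == 0).
Proof.
rewrite /lead; case: pickP => [i vi_neq0 | v0].
  rewrite (negPf vi_neq0); apply/esym/negbTE; apply: contraNneq vi_neq0 => ->.
  by rewrite ffunE.
by rewrite eqxx; apply/esym/eqP/ffunP => i; rewrite ffunE; apply/eqP/negbFE/v0.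
Qed.

Lemma lead_scale c v : lead (scale_ffun c v) = c * lead v.
Proof.
have [-> | c_neq0] := eqVneq c 0.
  rewrite mul0r; apply/eqP; rewrite lead_eq0; apply/eqP/ffunP => i.
  by rewrite !ffunE mul0r.
rewrite /lead (@eq_pick _ _ (fun i => v i != 0)) => [|i]; last first.
  by rewrite ffunE mulf_eq0 (negPf c_neq0).
by case: pickP => [i _ | _]; rewrite ?ffunE ?mulr0.
Qed.

Lemma lead_unit i : lead (unit_ffun i) = 1.
Proof.
rewrite /lead; case: pickP => [j | /(_ i)]; rewrite ffunE.
  by case: (i == j); rewrite ?eqxx.
by rewrite eqxx oner_eq0.
Qed.

Lemma unit_ffun_inj : injective unit_ffun.
Proof.
move=> i j /ffunP/(_ i)/eqP; rewrite !ffunE eqxx.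
by have [// | _] := eqVneq j i; rewrite oner_eq0.
Qed.

(** Distinct points are lines meeting only in 0: applying [lead] gives [a = b], and a nonzero [a]
    could be cancelled. *)
Lemma lead1_scale_inj a b v w : lead v = 1 -> lead w = 1 -> v != w ->
  scale_ffun a v = scale_ffun b w -> a = 0.
Proof.
move=> v1 w1 neq_vw eq_abvw; apply: contraNeq neq_vw => a_neq0.
have eq_ab : a = b by move/(congr1 lead): eq_abvw; rewrite !lead_scale v1 w1 !mulr1.
apply/eqP/ffunP => i; apply: (mulfI a_neq0).
by move/ffunP/(_ i): eq_abvw; rewrite !ffunE -eq_ab.
Qed.

End ProjectivePoints.

(** * Counting the points over a finite field *)

Section CountPoints.

Local Open Scope ring_scope.

Variables (K : finFieldType) (m : nat).

Definition points := [set v : {ffun 'I_m -> K} | lead v == 1].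

(** Each nonzero [v] is [lead v] times a normalized vector, so pairs of a nonzero scalar and a point
    cover all nonzero vectors. *)
Lemma card_points : (#|K| ^ m - 1 <= #|points| * (#|K| - 1))%N.
Proof.
pose A := setX [set c : K | c != 0] points.
have cardA : #|A| = (#|points| * (#|K| - 1))%N.
  rewrite cardsX mulnC subn1 -(cardC1 (0 : K)); congr (_ * _)%N.
  by apply: eq_card => c; rewrite !inE.
rewrite -cardA -{1}[m]card_ord -card_ffun subn1 -(cardC1 (0 : {ffun 'I_m -> K})).
apply: leq_trans (leq_imset_card (fun p => scale_ffun p.1 p.2) A).
apply/subset_leq_card/subsetP => v; rewrite !inE => v_neq0.
have lv_neq0 : lead v != 0 by rewrite lead_eq0.
apply/imsetP; exists (lead v, scale_ffun (lead v)^-1 v) => /=.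
  by rewrite !inE /= lv_neq0 lead_scale mulVf ?eqxx.
by apply/ffunP => i; rewrite !ffunE mulrA mulfV // mul1r.
Qed.

(** List the points with the [m] unit vectors first and keep the first [n] of them. *)
Lemma exists_spanning_points (n : nat) : (m <= n <= #|points|)%N ->
  exists f : 'I_n -> {ffun 'I_m -> K},
    [/\ injective f, forall i, lead (f i) = 1
      & forall i, exists j, f j = unit_ffun K i].
Proof.
case/andP=> le_mn le_nP; pose es := [seq unit_ffun K i | i <- enum 'I_m].
pose s := es ++ [seq v <- enum points | v \notin es].
have Ues : uniq es by rewrite map_inj_uniq ?enum_uniq //; apply: unit_ffun_inj.
have mem_s : s =i points.
  move=> v; rewrite mem_cat mem_filter mem_enum.
  have [/mapP[i _ ->] | _ //] := boolP (v \in es).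
  by rewrite inE lead_unit eqxx.
have Us : uniq s.
  rewrite cat_uniq Ues filter_uniq ?enum_uniq // andbT.
  by apply/hasPn => v; rewrite mem_filter => /andP[].
have size_s : size s = #|points| by rewrite -(card_uniqP Us); apply: eq_card.
have lt_s (i : 'I_n) : (i < size s)%N by rewrite size_s (leq_trans (ltn_ord i)).
exists (fun i => nth 0 s i); split=> [i j /eqP | i | i].
- by rewrite nth_uniq // => /eqP/val_inj.
- by apply/eqP; have := mem_nth 0 (lt_s i); rewrite mem_s inE.
- exists (widen_ord le_mn i) => /=.
  rewrite nth_cat size_map size_enum_ord ltn_ord.
  by rewrite (nth_map i) ?size_enum_ord // nth_ord_enum.
Qed.

End CountPoints.

Lemma dim_pair (R : nzSemiRingType) (uT vT : semiVectType R) :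
  dim (uT * vT)%type = dim uT + dim vT.
Proof. by []. Qed.

Lemma dim_ffun (R : nzSemiRingType) (I : finType) (vT : semiVectType R) :
  dim {ffun I -> vT} = #|I| * dim vT.
Proof. by []. Qed.

(** * Petals [V0 x K v] around the center [V0 x 0] *)

Section Sunflower.

Local Open Scope ring_scope.

Variables (F : fieldType) (K : fieldExtType F) (V0 : vectType F) (m : nat).
Local Notation V := (V0 * {ffun 'I_m -> K})%type.
Implicit Types v w : {ffun 'I_m -> K}.

(** Presenting petals and center as images of [F]-linear maps reduces their dimensions to
    injectivity. *)
Definition petal_fun v (p : V0 * K) : V := (p.1, scale_ffun p.2 v).

Fact petal_fun_linear v : linear (petal_fun v).
Proof.
move=> a p q; congr (_, _); apply/ffunP => i.
by rewrite !ffunE mulrDl scalerAl.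
Qed.

HB.instance Definition _ v :=
  GRing.isLinear.Build F (V0 * K)%type V _ (petal_fun v) (petal_fun_linear v).

Definition petal v : {vspace V} := limg (linfun (petal_fun v)).

Definition center_fun (u : V0) : V := (u, 0).

Fact center_fun_linear : linear center_fun.
Proof. by move=> a u u'; congr (_, _); rewrite /= scaler0 addr0. Qed.

HB.instance Definition _ :=
  GRing.isLinear.Build F V0 V _ center_fun center_fun_linear.

Definition center : {vspace V} := limg (linfun center_fun).

Lemma mem_petal v (x : V) :
  reflect (exists a : K, x.2 = scale_ffun a v) (x \in petal v).
Proof.
apply: (iffP memv_imgP) => [[p _ ->] | [a Dx]].
  by rewrite lfunE; exists p.2.
by exists (x.1, a); rewrite ?memvf // lfunE /= /petal_fun -Dx; case: x {Dx}.
Qed.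

Lemma mem_center (x : V) : (x \in center) = (x.2 == 0).
Proof.
apply/memv_imgP/eqP => [[u _ ->] | Dx]; first by rewrite lfunE.
by exists x.1; rewrite ?memvf // lfunE /= /center_fun -Dx; case: x {Dx}.
Qed.

Lemma dim_petal v : v != 0 -> \dim (petal v) = (dim V0 + \dim {:K})%N.
Proof.
move=> v_neq0; rewrite limg_dim_eq ?dimvf //; apply/eqP; rewrite -subv0.
apply/subvP => -[u a]; rewrite memv_cap memvf memv_ker lfunE /= memv0.
case/eqP=> -> /ffunP va0; apply/eqP; congr (_, _).
have lv_neq0 : lead v != 0 by rewrite lead_eq0.
apply: (mulIf lv_neq0); rewrite mul0r -lead_scale; apply/eqP; rewrite lead_eq0.
exact/eqP/ffunP.
Qed.

Lemma dim_center : \dim center = dim V0.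
Proof.
rewrite limg_dim_eq ?dimvf //; apply/eqP; rewrite -subv0.
apply/subvP => u; rewrite memv_cap memvf memv_ker lfunE /= memv0.
by case/eqP=> ->.
Qed.

Lemma petal_cap v w : lead v = 1 -> lead w = 1 -> v != w ->
  (petal v :&: petal w)%VS = center.
Proof.
move=> v1 w1 neq_vw; apply/vspaceP => x; rewrite memv_cap mem_center.
apply/andP/eqP => [[/mem_petal[a Dx] /mem_petal[b Dx']] | Dx].
  have a0 := lead1_scale_inj v1 w1 neq_vw (etrans (esym Dx) Dx').
  by rewrite Dx a0; apply/ffunP => i; rewrite !ffunE mul0r.
by split; apply/mem_petal; exists 0; rewrite Dx; apply/ffunP => i;
   rewrite !ffunE mul0r.
Qed.

Lemma sum_petals (n : nat) (f : 'I_n -> {ffun 'I_m -> K}) :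
  (0 < n)%N -> (forall i, exists j, f j = unit_ffun K i) ->
  (\sum_(j < n) petal (f j))%VS = fullv.
Proof.
move=> n_gt0 f_unit; apply/eqP; rewrite eqEsubv subvf; apply/subvP => x _.
set S := (\sum_(j < n) _)%VS.
have in_S j y : y \in petal (f j) -> y \in S.
  by apply/subvP; rewrite /S (sumv_sup j).
(* The first summand lies in the center, hence in every petal; the others lie in the petals of the
   coordinate axes. *)
have -> : x = (x.1, 0) + \sum_i ((0, scale_ffun (x.2 i) (unit_ffun K i)) : V).
  case: x => u v /=; rewrite [RHS]surjective_pairing /=.
  rewrite (big_morph fst (id1 := 0) (op1 := +%R)) //.
  rewrite (big_morph snd (id1 := 0) (op1 := +%R)) //= big1_eq addr0 add0r.
  congr (_, _); apply/ffunP => j; rewrite sum_ffunE (bigD1 j) //= !ffunE eqxx.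
  rewrite mulr1 big1 ?addr0 // => i /negPf neq_ij.
  by rewrite !ffunE neq_ij mulr0.
rewrite memvD ?memv_suml // => [|i _].
  apply: (in_S (Ordinal n_gt0)); apply/mem_petal; exists 0.
  by apply/ffunP => i; rewrite !ffunE mul0r.
have [j <-] := f_unit i; apply: (in_S j); apply/mem_petal.
by exists (x.2 i).
Qed.

End Sunflower.

Theorem theorem7 (F : finFieldType) (k t n eta : nat)
    (t_gt0 : 1 <= t) (le_tk : t <= k)
    (eta_gt0 : 1 <= eta) (le_eta_n : eta <= n - 2)
    (le_n : n <= (#|F| ^ (t * (n - eta)) - 1) %/ (#|F| ^ t - 1)) :
  exists (V : vectType F) (pi : 'I_n -> {vspace V}),
    [/\ injective pi,
        SCID k (k - t) (mem (codom pi))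
      & \dim (\sum_(i < n) pi i)%VS
        + \dim (\sum_(i < n) \sum_(j < n | i != j) (pi i :&: pi j))%VS
        = 2 * k + (n - 2) * t - eta * t].
Proof.
have [L dimL] := finField_ext_exists F t_gt0.
(* [finvect_type] gives [L] the finite structure needed for counting. *)
pose K := finvect_type L; pose m := n - eta.
have dimK : \dim {:K} = t by [].
have cardK : #|K| = #|F| ^ t.
  rewrite -dimK -(@card_vspace F K _ {:K}%VS).
  by apply: eq_card => x; rewrite (memvf (x : L)).
have n_gt2 : 2 < n by lia.
have K_gt1 : 0 < #|K| - 1 by rewrite subn_gt0 finNzRing_gt1.
have [f [f_inj f1 f_unit]] : exists f : 'I_n -> {ffun 'I_m -> K},
    [/\ injective f, forall i, lead (f i) = 1%R
      & forall i, exists j, f j = unit_ffun K i].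
  apply: exists_spanning_points; rewrite leq_subr (leq_trans le_n) //.
  rewrite expnM -cardK -(mulnK #|points K m| K_gt1).
  exact/leq_div2r/card_points.
pose V0 := 'rV[F]_(k - t).
have dimV0 : dim V0 = k - t by rewrite dim_matrix [LHS]mul1n.
pose pi i := petal V0 (f i).
have dim_pi i : \dim (pi i) = k.
  rewrite dim_petal ?dimV0 ?dimK ?subnK //.
  by rewrite -lead_eq0 f1 GRing.oner_eq0.
have pi_cap i j : i != j -> (pi i :&: pi j)%VS = center K V0 m.
  by move=> neq_ij; rewrite petal_cap // (inj_eq f_inj).
have dim_cap i j : i != j -> \dim (pi i :&: pi j) = k - t.
  by move/pi_cap->; rewrite dim_center.
(* Equal petals at distinct indices would meet in dimension [k], not [k - t]. *)
have pi_inj : injective pi.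
  move=> i j eq_pi; apply/eqP; apply: contraT => /dim_cap.
  by rewrite eq_pi capvv dim_pi; lia.
pose i0 : 'I_n := Ordinal (ltnW (ltnW n_gt2)).
pose i1 : 'I_n := Ordinal (ltnW n_gt2).
exists (V0 * {ffun 'I_m -> K})%type, pi; split=> //.
  split=> [|_ /codomP[i ->] // | _ _ /codomP[i ->] /codomP[j ->]].
    by exists (pi i0), (pi i1); rewrite !codom_f (inj_eq pi_inj).
  by rewrite (inj_eq pi_inj); apply: dim_cap.
(* Every term is the center, and the pair [i0], [i1] shows that there is at least one term. *)
have -> : (\sum_i \sum_(j | i != j) (pi i :&: pi j))%VS = center K V0 m.
  apply/eqP; rewrite eqEsubv; apply/andP; split.
    by apply/subv_sumP => i _; apply/subv_sumP => j neq_ij; rewrite pi_cap.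
  by rewrite (sumv_sup i0) // (sumv_sup i1) // pi_cap.
rewrite sum_petals ?(ltnW (ltnW n_gt2)) // dim_center dimV0 dimvf.
have -> : dim (V0 * {ffun 'I_m -> K})%type = k - t + m * t.
  by rewrite dim_pair dim_ffun card_ord dimV0 -dimvf dimK.
(* Writing [n] as [r + 2 + eta] removes the truncated subtractions; both sides become
   [2 * k + r * t]. *)
have [r Dn] : exists r, n = r + 2 + eta by exists (n - 2 - eta); lia.
have -> : m = r + 2 by rewrite /m; lia.
have -> : n - 2 = r + eta by lia.
by rewrite !mulnDl; lia.
Qed.
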